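(* Let $X$ be a quasi-Banach function space over $\mathbf{R}^d$ with the Fatou property. If $M:X\to X$ is bounded, then $M:X''\to X''$ is bounded with $\|M\|_{X''\to X''}\le\|M\|_{X\to X}$.
   Context: A quasi-Banach function space over $\mathbf{R}^d$ is a complete quasi-normed space $X\subseteq L^0(\mathbf{R}^d)$ with the ideal property (if $f\in X$, $|g|\le|f|$ then $g\in X$, $\|g\|_X\le\|f\|_X$) and the saturation property (every set of positive measure contains a subset $F$ of positive measure with $\mathbf{1}_F\in X$). Köthe dual: $X'=\{g:fg\in L^1\ \forall f\in X\}$ with $\|g\|_{X'}=\sup_{\|f\|_X=1}\int|fg|$; $X''=(X')'$. Fatou property: $0\le f_n\uparrow f$ a.e., $\sup\|f_n\|_X<\infty$ imply $f\in X$, $\|f\|_X=\sup\|f_n\|_X$. $M$ is the Hardy–Littlewood maximal operator over axis-parallel cubes. *)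

(* Defs.v *)
From HB Require Import structures.
From mathcomp Require Import all_boot all_order all_algebra.
From mathcomp Require Import all_classical all_reals all_analysis.
Set Implicit Arguments. Unset Strict Implicit. Unset Printing Implicit Defensive.
Import Order.TTheory GRing.Theory Num.Theory.
Import numFieldNormedType.Exports.
Local Open Scope classical_set_scope.
Local Open Scope ring_scope.

(* R^d is modelled as [d.-tuple R], with the product (= Borel) sigma-algebra
   provided by mathcomp-analysis (generated by the coordinate projections). *)

(* Lebesgue integral over R^d of a nonnegative function, defined as the
   iterated integral with respect to the Lebesgue measure on R
   (by Tonelli this is the Lebesgue integral w.r.t. the d-fold product
   of Lebesgue measure for nonnegative measurable functions). *)
Fixpoint intRd {R : realType} (n : nat) : (n.-tuple R -> \bar R) -> \bar R :=
  match n return (n.-tuple R -> \bar R) -> \bar R with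
  | 0 => fun f => f [tuple]
  | n'.+1 => fun f =>
      (\int[@lebesgue_measure R]_x intRd (fun t : n'.-tuple R => f (cons_tuple x t)))%E
  end.

Definition lebRd {R : realType} (n : nat) (A : set (n.-tuple R)) : \bar R :=
  intRd (fun x => (\1_A x : R)%:E).

Definition nullRd {R : realType} (n : nat) (N : set (n.-tuple R)) : Prop :=
  measurable N /\ lebRd N = 0%E.

Definition aeRd {R : realType} (n : nat) (P : n.-tuple R -> Prop) : Prop :=
  exists N : set (n.-tuple R), nullRd N /\ (forall x, ~ N x -> P x).

Definition cube {R : realType} (n : nat) (a : n.-tuple R) (l : R)
  : set (n.-tuple R) :=
  [set y | forall i : 'I_n, tnth a i <= tnth y i <= tnth a i + l].

Definition HLmax {R : realType} (n : nat) (f : n.-tuple R -> R)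
  (x : n.-tuple R) : \bar R :=
  ereal_sup [set v | exists (a : n.-tuple R) (l : R),
     [/\ 0 < l, cube a l x &
      v = (((l ^+ n)^-1)%:E *
           intRd (fun y => (`|f y| * (\1_(cube a l) y : R))%:E))%E]].

Definition is_QBFS {R : realType} (n : nat) (X : set (n.-tuple R -> R))
  (nrm : (n.-tuple R -> R) -> R) : Prop :=
  (forall f, X f -> measurable_fun setT f) /\
  X (fun=> 0) /\
  (forall f g, X f -> X g -> X (fun x => f x + g x)) /\
  (forall (c : R) f, X f -> X (fun x => c * f x)) /\
  (forall f, X f -> 0 <= nrm f) /\
  (forall f, X f -> (nrm f = 0 <-> aeRd (fun x => f x = 0))) /\
  (forall (c : R) f, X f -> nrm (fun x => c * f x) = `|c| * nrm f) /\
  (exists K : R, 1 <= K /\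
     forall f g, X f -> X g -> nrm (fun x => f x + g x) <= K * (nrm f + nrm g)) /\
  (forall u : nat -> n.-tuple R -> R, (forall k, X (u k)) ->
     (forall e : R, 0 < e -> exists N : nat, forall m k : nat,
        (N <= m)%N -> (N <= k)%N -> nrm (fun x => u m x - u k x) < e) ->
     exists f, X f /\ (fun k => nrm (fun x => u k x - f x)) @ \oo --> (0 : R)) /\
  (forall f (g : n.-tuple R -> R), X f -> measurable_fun setT g ->
     aeRd (fun x => `|g x| <= `|f x|) -> X g /\ nrm g <= nrm f) /\
  (forall A : set (n.-tuple R), measurable A -> (0 < lebRd A)%E ->
     exists F : set (n.-tuple R), [/\ measurable F, F `<=` A, (0 < lebRd F)%E
                                     & X (fun x => \1_F x : R)]).

Definition has_Fatou {R : realType} (n : nat) (X : set (n.-tuple R -> R))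
  (nrm : (n.-tuple R -> R) -> R) : Prop :=
  forall (u : nat -> n.-tuple R -> R) (f : n.-tuple R -> R),
    (forall k, X (u k)) -> measurable_fun setT f ->
    aeRd (fun x => (forall k, 0 <= u k x <= u k.+1 x) /\
                   (fun k => u k x) @ \oo --> f x) ->
    (exists B : R, forall k, nrm (u k) <= B) ->
    X f /\ (nrm f)%:E = ereal_sup (range (fun k => (nrm (u k))%:E)).

Definition kothe {R : realType} (n : nat) (X : set (n.-tuple R -> R))
  : set (n.-tuple R -> R) :=
  [set g | measurable_fun setT g /\
     forall f, X f -> (intRd (fun x => (`|f x * g x|)%:E) < +oo)%E].

(* ||g||_{X'} = sup_{f in X, ||f||_X = 1} \int |f g|
   (the sup of the empty family being 0). *)
Definition kothe_norm {R : realType} (n : nat) (X : set (n.-tuple R -> R))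
  (nrm : (n.-tuple R -> R) -> \bar R) (g : n.-tuple R -> R) : \bar R :=
  ereal_sup ([set 0%E] `|`
    [set intRd (fun x => (`|f x * g x|)%:E) | f in [set f | X f /\ nrm f = 1%E]]).

Definition M_bounded {R : realType} (n : nat) (X : set (n.-tuple R -> R))
  (nrm : (n.-tuple R -> R) -> \bar R) (C : R) : Prop :=
  forall f, X f ->
    [/\ aeRd (fun x => (HLmax f x < +oo)%E),
        X (fine \o HLmax f) &
        (nrm (fine \o HLmax f) <= C%:E * nrm f)%E].

(* Main.v *)
(* The maximal operator is the supremum of the averages over countably many
   rational cubes. For a fixed f, the maximum of the first k of these averages
   of |f| coincides at f with a positive linear operator T, of the form
   T u = sum_j 1_(E_j) avg_(Q_j) u with disjoint E_j in Q_j, and T |u| <= M u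
   for all u. Its adjoint T* therefore maps X' to X' with norm at most C, so for
   f in X'' and g in X'
     int (T |f|) |g| = int |f| (T* |g|) <= C ||f||_X'' ||g||_X',
   and monotone convergence in k gives the bound for M f. *)

Require Import Defs.
From HB Require Import structures.
From mathcomp Require Import all_boot all_order all_algebra.
From mathcomp Require Import all_classical all_reals all_analysis.
From mathcomp Require Import measurable_realfun lra.
Import Order.TTheory GRing.Theory Num.Theory.
Import numFieldNormedType.Exports.
Local Open Scope classical_set_scope.
Local Open Scope ring_scope.
Set Implicit Arguments. Unset Strict Implicit. Unset Printing Implicit Defensive.

(** The displayed chain bounds a norm but does not place M f in X''. Membership there means a finite
    pairing with each g in X' separately, and finiteness of the Köthe norms of f and g is not part
    of the definitions, so it cannot be read off from a product of norms. A gliding hump replaces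
    that product: infinite pairings are excluded qualitatively, and the quantitative estimate is
    made only against g of norm 1. A second obstacle is that saturation supplies few test functions,
    not the indicators of bounded cubes. Boundedness of M supplies them on both sides. Since M 1_F
    is bounded below on every cube, cubes have indicators in X, which forces a function pairing
    finitely with X to be finite a.e. Since M u is finite somewhere on every cube, each u in X is
    locally integrable, so these indicators are in X' too, which makes M f finite a.e. for f in X''.
    No convexity of the quasi-norm enters: the adjoint is estimated by testing it on one u in X at a
    time. *)

(** * From iterated integrals to a measure *)

Lemma sigma_finite_product (d1 d2 : measure_display)
    (T1 : measurableType d1) (T2 : measurableType d2) (R : realType)
    (m1 : {sigma_finite_measure set T1 -> \bar R})
    (m2 : {sigma_finite_measure set T2 -> \bar R}) :
  sigma_finite setT (m1 \x m2)%E.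
Proof.
have /sigma_finiteP[F [TF ndF Foo]] := sigma_finiteT m1.
have /sigma_finiteP[G [TG ndG Goo]] := sigma_finiteT m2.
exists (fun k => F k `*` G k); last first.
  move=> k; have [mF Fk] := Foo k; have [mG Gk] := Goo k.
  split; first exact: measurableX.
  by rewrite product_measure1E// lte_mul_pinfty// ge0_fin_numE.
apply/esym; rewrite -subTset => -[x y] _.
have [i _ Fix] : (\bigcup_i F i) x by rewrite -TF.
have [j _ Gjy] : (\bigcup_j G j) y by rewrite -TG.
exists (maxn i j) => //; split => /=.
- by have /subsetPset := ndF _ _ (leq_maxl i j); exact.
- by have /subsetPset := ndG _ _ (leq_maxr i j); exact.
Qed.

Lemma sigma_finite_pushforward (d1 d2 : measure_display)
    (T1 : measurableType d1) (T2 : measurableType d2) (R : realType)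
    (mu : {measure set T1 -> \bar R}) (f : T1 -> T2) (g : T2 -> T1) :
  sigma_finite setT mu ->
  measurable_fun setT f -> measurable_fun setT g -> cancel f g ->
  exists nu : {sigma_finite_measure set T2 -> \bar R},
    forall A, nu A = pushforward mu f A.
Proof.
move=> [F TF mF] mf mg fK.
pose nu0 : {measure set T2 -> \bar R} := pushforward mu f.
pose nu := nu0 mf.
have sf : sigma_finite setT nu.
  exists (fun i => g @^-1` F i); first by rewrite -preimage_bigcup -TF.
  move=> i; split.
    by rewrite -[X in measurable X]setTI; apply: mg => //; exact: (mF i).1.
  rewrite /nu /= /pushforward -comp_preimage.
  by rewrite (_ : g \o f = id); [exact: (mF i).2|exact/funext].
pose H2 := isSFinite.Build _ _ _ nu (sfinite_measure_sigma_finite sf).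
pose H3 := isSigmaFinite.Build _ _ _ nu sf.
by exists (HB.pack_for (SigmaFiniteMeasure.type T2 R) (Measure.sort nu) H2 H3).
Qed.

(** Gives access to linearity, monotone convergence and a.e. arguments, which the bare recursion
    [intRd] does not offer. The measure is built by pushing the product forward along [cons];
    sigma-finiteness is carried through the induction because Tonelli requires it at the next
    dimension. *)
Lemma intRd_measure (R : realType) (n : nat) :
  exists mu : {sigma_finite_measure set (n.-tuple R) -> \bar R},
    forall f : n.-tuple R -> \bar R, (forall x, (0 <= f x)%E) ->
      measurable_fun setT f -> intRd f = (\int[mu]_x f x)%E.
Proof.
elim: n => [|n [mu IH]].
  exists (\d_([tuple] : 0.-tuple R)) => f f0 mf.
  by rewrite integral_dirac// diracT mul1e.
pose cns (z : measurableTypeR R * n.-tuple R) : n.+1.-tuple R :=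
  [the n.+1.-tuple R of z.1 :: z.2].
have mcns : measurable_fun setT cns by exact: measurable_cons.
pose unc (t : n.+1.-tuple R) : measurableTypeR R * n.-tuple R :=
  (thead t, [tuple of behead t]).
have munc : measurable_fun setT unc.
  apply/measurable_fun_pairP; split; last exact: measurable_behead.
  exact: measurable_tnth.
pose lam : {sigma_finite_measure set (measurableTypeR R) -> \bar R} :=
  @lebesgue_measure R.
have cnsK : cancel cns unc.
  by move=> [x t]; congr pair => //=; exact/val_inj.
have [nu nuE] := sigma_finite_pushforward
  (sigma_finite_product lam mu) mcns munc cnsK.
exists nu => f f0 mf.
pose nu1 : {measure set (n.+1.-tuple R) -> \bar R} := pushforward (lam \x mu)%E cns.
rewrite (eq_measure_integral (nu1 mcns)) => [|A _ _]; last exact: nuE.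
rewrite (ge0_integral_pushforward mcns)// preimage_setT fubini_tonelli1.
- apply: eq_integral => x _.
  rewrite -/(intRd (fun t : n.-tuple R => f (cons_tuple x t))) IH//.
  apply: (measurableT_comp mf).
  have mx : measurable_fun [set: n.-tuple R] (fun=> (x : R)).
    exact: measurable_cst.
  exact: (measurable_cons mx (@measurable_id _ _ setT)).
- exact: (measurableT_comp mf mcns).
- by move=> x; exact: f0.
Qed.

Local Open Scope ereal_scope.

(** * Finite maxima of averages and their duality *)

(** In the application [Q k] is a cube and [c k] its reciprocal volume; the duality argument only
    needs [Q k] measurable and [c k] nonnegative. *)
Definition avg_op (d : measure_display) (T : measurableType d) (R : realType)
    (mu : {measure set T -> \bar R}) (Q : nat -> set T) (c : nat -> R)
    (k : nat) (f : T -> \bar R) : \bar R :=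
  (c k)%:E * \int[mu]_x (f x * (\1_(Q k) x)%:E).

Fixpoint max_op (d : measure_display) (T : measurableType d) (R : realType)
    (mu : {measure set T -> \bar R}) (Q : nat -> set T) (c : nat -> R)
    (n : nat) (f : T -> \bar R) (x : T) : \bar R :=
  if n is k.+1 then
    maxe (max_op mu Q c k f x) (avg_op mu Q c k f * (\1_(Q k) x)%:E)
  else 0.

Lemma avg_op_ge0 (d : measure_display) (T : measurableType d) (R : realType)
    (mu : {measure set T -> \bar R}) (Q : nat -> set T) (c : nat -> R)
    (k : nat) (f : T -> \bar R) :
  (forall k, (0 <= c k)%R) -> (forall x, 0 <= f x) -> 0 <= avg_op mu Q c k f.
Proof.
move=> c0 f0; apply: mule_ge0; first by rewrite lee_fin.
by apply: integral_ge0 => x _; rewrite mule_ge0// lee_fin.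
Qed.

Lemma max_op_ge0 (d : measure_display) (T : measurableType d) (R : realType)
    (mu : {measure set T -> \bar R}) (Q : nat -> set T) (c : nat -> R)
    (n : nat) (f : T -> \bar R) (x : T) : 0 <= max_op mu Q c n f x.
Proof. by elim: n => //= n IH; rewrite le_max IH. Qed.

Lemma measurable_max_op (d : measure_display) (T : measurableType d) (R : realType)
    (mu : {measure set T -> \bar R}) (Q : nat -> set T) (c : nat -> R)
    (n : nat) (f : T -> \bar R) :
  (forall k, measurable (Q k)) -> measurable_fun setT (max_op mu Q c n f).
Proof.
move=> mQ; elim: n => [|n IH] /=; first exact: measurable_cst.
apply: measurable_maxe => //; apply: measurable_funeM.
exact/measurable_EFinP/measurable_indic.
Qed.

Lemma max_op_nd (d : measure_display) (T : measurableType d) (R : realType)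
    (mu : {measure set T -> \bar R}) (Q : nat -> set T) (c : nat -> R)
    (f : T -> \bar R) (x : T) :
  nondecreasing_seq (fun n => max_op mu Q c n f x).
Proof. by apply/nondecreasing_seqP => n /=; rewrite le_max lexx. Qed.

(** The operator has the symmetric kernel c 1_Q(x) 1_Q(y), so it is its own transpose. *)
Lemma avg_op_adjoint (d : measure_display) (T : measurableType d) (R : realType)
    (mu : {measure set T -> \bar R}) (Q : nat -> set T) (c : nat -> R)
    (k : nat) (f g : T -> \bar R) :
  (forall k, measurable (Q k)) -> (forall k, (0 <= c k)%R) ->
  (forall x, 0 <= f x) -> measurable_fun setT f ->
  (forall x, 0 <= g x) -> measurable_fun setT g ->
  \int[mu]_x (f x * (avg_op mu Q c k g * (\1_(Q k) x)%:E)) =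
  \int[mu]_x (g x * (avg_op mu Q c k f * (\1_(Q k) x)%:E)).
Proof.
move=> mQ c0 f0 mf g0 mg.
have m1 : measurable_fun setT (fun x => (\1_(Q k) x : R)%:E).
  exact/measurable_EFinP/measurable_indic.
have pull (u v : T -> \bar R) : (forall x, 0 <= u x) -> measurable_fun setT u ->
    (forall x, 0 <= v x) ->
    \int[mu]_x (u x * (avg_op mu Q c k v * (\1_(Q k) x)%:E)) =
    avg_op mu Q c k v * \int[mu]_x (u x * (\1_(Q k) x)%:E).
  move=> u0 mu_ v0; under eq_integral do rewrite muleCA.
  rewrite ge0_integralZl//.
  - exact: emeasurable_funM.
  - by move=> x _; rewrite mule_ge0// lee_fin.
  - exact: avg_op_ge0.
by rewrite !pull// /avg_op muleAC.
Qed.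

(* By induction on n, splitting w along the set where the n-th average of f
   exceeds the maximum of the previous ones. *)
Lemma max_op_dual (d : measure_display) (T : measurableType d) (R : realType)
    (mu : {measure set T -> \bar R}) (Q : nat -> set T) (c : nat -> R)
    (n : nat) (w f : T -> \bar R) :
  (forall k, measurable (Q k)) -> (forall k, (0 <= c k)%R) ->
  (forall x, 0 <= w x) -> measurable_fun setT w ->
  (forall x, 0 <= f x) -> measurable_fun setT f ->
  exists h : T -> \bar R, [/\ forall x, 0 <= h x, measurable_fun setT h,
    \int[mu]_x (w x * max_op mu Q c n f x) = \int[mu]_x (f x * h x) &
    forall g : T -> \bar R, (forall x, 0 <= g x) -> measurable_fun setT g ->
      \int[mu]_x (g x * h x) <= \int[mu]_x (w x * max_op mu Q c n g x)].
Proof.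
move=> mQ c0 + + f0 mf; elim: n w => [|n IH] w w0 mw.
  exists (fun=> 0); split => //.
  - by under eq_integral do rewrite /= mule0; under [RHS]eq_integral do rewrite mule0.
  - move=> g g0 mg; under eq_integral do rewrite mule0.
    by under [leRHS]eq_integral do rewrite /= mule0.
have m1 : measurable_fun setT (fun x => (\1_(Q n) x : R)%:E).
  exact/measurable_EFinP/measurable_indic.
pose v (g : T -> \bar R) x := avg_op mu Q c n g * (\1_(Q n) x)%:E.
have v0 g x : (forall x, 0 <= g x) -> 0 <= v g x.
  by move=> g0; rewrite mule_ge0 ?lee_fin//; exact: avg_op_ge0.
have mv g : measurable_fun setT (v g) by exact: measurable_funeM.
have mM g := @measurable_max_op _ _ _ mu Q c n g mQ.
have M0 g x := @max_op_ge0 _ _ _ mu Q c n g x.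
pose A := [set x | max_op mu Q c n f x < v f x].
have mA : measurable A.
  by rewrite -[A]setTI; exact: emeasurable_fun_lt.
pose w1 x := w x * (\1_A x)%:E.
pose w2 x := w x * (\1_(~` A) x)%:E.
have w10 x : 0 <= w1 x by rewrite mule_ge0// lee_fin.
have w20 x : 0 <= w2 x by rewrite mule_ge0// lee_fin.
have mw1 : measurable_fun setT w1.
  by apply: emeasurable_funM => //; exact/measurable_EFinP/measurable_indic.
have mw2 : measurable_fun setT w2.
  apply: emeasurable_funM => //; apply/measurable_EFinP/measurable_indic.
  exact: measurableC.
have split_w g : (forall x, 0 <= g x) ->
    \int[mu]_x (w1 x * v g x + w2 x * max_op mu Q c n g x) =
    \int[mu]_x (w1 x * v g x) + \int[mu]_x (w2 x * max_op mu Q c n g x).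
  move=> g0; rewrite ge0_integralD//.
  - by move=> x _; rewrite mule_ge0// v0.
  - exact: emeasurable_funM.
  - by move=> x _; rewrite mule_ge0.
  - exact: emeasurable_funM.
have [h [h0 mh hf hle]] := IH _ w20 mw2.
(* Being self-adjoint, the n-th averaging operator moves from [g] to [w1] unchanged; the induction
   hypothesis does the corresponding work for [w2]. *)
pose k x := avg_op mu Q c n w1 * (\1_(Q n) x)%:E.
have k0 x : 0 <= k x by rewrite mule_ge0 ?lee_fin//; exact: avg_op_ge0.
have mk : measurable_fun setT k by exact: measurable_funeM.
have split_h g : (forall x, 0 <= g x) -> measurable_fun setT g ->
    \int[mu]_x (g x * (k x + h x)) =
    \int[mu]_x (w1 x * v g x) + \int[mu]_x (g x * h x).
  move=> g0 mg; under eq_integral do rewrite ge0_muleDr//.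
  rewrite ge0_integralD//.
  - by rewrite avg_op_adjoint.
  - by move=> x _; rewrite mule_ge0.
  - exact: emeasurable_funM.
  - by move=> x _; rewrite mule_ge0.
  - exact: emeasurable_funM.
exists (fun x => k x + h x); split.
- by move=> x; rewrite adde_ge0.
- exact: emeasurable_funD.
- rewrite split_h// -hf -split_w//; apply: eq_integral => x _ /=.
  rewrite -/(v f x) /w1 /w2 !indicE in_setC.
  have [xA|xA] := boolP (x \in A).
    rewrite /= mule1 mule0 mul0e adde0 max_r//.
    by move: xA; rewrite inE => /ltW.
  rewrite /= mule1 mule0 mul0e add0e max_l//.
  by rewrite leNgt; apply: contra xA => xA; rewrite inE.
- move=> g g0 mg; rewrite split_h//.
  (* At [f] the splitting selects the larger term, hence equality; at another [g] the selected term
     is merely one of those in the maximum. *)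
  apply: (@le_trans _ _ (\int[mu]_x (w1 x * v g x + w2 x * max_op mu Q c n g x))).
    by rewrite split_w// leeD2l// hle.
  apply: ge0_le_integral => //.
  + by move=> x _; rewrite adde_ge0// mule_ge0// v0.
  + by apply: emeasurable_funD; exact: emeasurable_funM.
  + by apply: emeasurable_funM => //; exact: (@measurable_max_op _ _ _ mu Q c n.+1 g mQ).
  + move=> x _ /=; rewrite -/(v g x) /w1 /w2 !indicE in_setC.
    case: (x \in A) => /=.
      by rewrite mule1 mule0 mul0e adde0 lee_wpmul2l// le_max lexx orbT.
    by rewrite mule1 mule0 mul0e add0e lee_wpmul2l// le_max lexx.
Qed.

(** * Passage to the countable supremum *)

Definition sup_op (d : measure_display) (T : measurableType d) (R : realType)
    (mu : {measure set T -> \bar R}) (Q : nat -> set T) (c : nat -> R)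
    (f : T -> \bar R) (x : T) : \bar R :=
  ereal_sup (range (fun n => max_op mu Q c n f x)).

Lemma sup_op_cvg (d : measure_display) (T : measurableType d) (R : realType)
    (mu : {measure set T -> \bar R}) (Q : nat -> set T) (c : nat -> R)
    (f : T -> \bar R) (x : T) :
  max_op mu Q c n f x @[n --> \oo] --> sup_op mu Q c f x.
Proof. by apply: ereal_nondecreasing_cvgn; exact: max_op_nd. Qed.

Lemma max_op_le_sup_op (d : measure_display) (T : measurableType d) (R : realType)
    (mu : {measure set T -> \bar R}) (Q : nat -> set T) (c : nat -> R)
    (n : nat) (f : T -> \bar R) (x : T) :
  max_op mu Q c n f x <= sup_op mu Q c f x.
Proof. by apply: ereal_sup_ubound; exists n. Qed.

Lemma sup_op_ge0 (d : measure_display) (T : measurableType d) (R : realType)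
    (mu : {measure set T -> \bar R}) (Q : nat -> set T) (c : nat -> R)
    (f : T -> \bar R) (x : T) : 0 <= sup_op mu Q c f x.
Proof. exact: (max_op_le_sup_op mu Q c 0). Qed.

Lemma measurable_sup_op (d : measure_display) (T : measurableType d) (R : realType)
    (mu : {measure set T -> \bar R}) (Q : nat -> set T) (c : nat -> R)
    (f : T -> \bar R) :
  (forall k, measurable (Q k)) -> measurable_fun setT (sup_op mu Q c f).
Proof.
move=> mQ; apply: (emeasurable_fun_cvg (fun n => max_op mu Q c n f)).
- by move=> n; exact: measurable_max_op.
- by move=> x _; exact: sup_op_cvg.
Qed.

Lemma integral_sup_op (d : measure_display) (T : measurableType d) (R : realType)
    (mu : {measure set T -> \bar R}) (Q : nat -> set T) (c : nat -> R)
    (w : T -> R) (f : T -> \bar R) :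
  (forall k, measurable (Q k)) ->
  (forall x, (0 <= w x)%R) -> measurable_fun setT w ->
  \int[mu]_x ((w x)%:E * sup_op mu Q c f x) =
  ereal_sup (range (fun n => \int[mu]_x ((w x)%:E * max_op mu Q c n f x))).
Proof.
move=> mQ w0 mw.
have mg n : measurable_fun setT (fun x => (w x)%:E * max_op mu Q c n f x).
  apply: emeasurable_funM; first exact/measurable_EFinP.
  exact: measurable_max_op.
have g0 n x : 0 <= (w x)%:E * max_op mu Q c n f x.
  by rewrite mule_ge0 ?lee_fin//; exact: max_op_ge0.
have nd x : nondecreasing_seq (fun n => (w x)%:E * max_op mu Q c n f x).
  by move=> m n mn; rewrite lee_wpmul2l ?lee_fin//; exact: max_op_nd.
transitivity (\int[mu]_x limn (fun n => (w x)%:E * max_op mu Q c n f x)).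
  apply: eq_integral => x _; apply/esym/cvg_lim => //.
  by apply: cvgeZl => //; exact: sup_op_cvg.
rewrite monotone_convergence//.
apply/cvg_lim => //; apply: ereal_nondecreasing_cvgn => m n mn.
by apply: ge0_le_integral => // x _; exact: nd.
Qed.

(** * Lebesgue measure, cubes and an exhaustion by boxes *)

Definition represents_intRd (R : realType) (n : nat)
    (mu : {measure set (n.-tuple R) -> \bar R}) : Prop :=
  forall f : n.-tuple R -> \bar R, (forall x, 0 <= f x) ->
    measurable_fun setT f -> intRd f = \int[mu]_x f x.

Lemma represents_intRd_lebRd (R : realType) (n : nat)
    (mu : {measure set (n.-tuple R) -> \bar R}) (A : set (n.-tuple R)) :
  represents_intRd mu -> measurable A -> lebRd A = mu A.
Proof.
move=> muE mA; rewrite /lebRd muE => [|x|]; last 2 first.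
- by rewrite lee_fin.
- exact/measurable_EFinP/measurable_indic.
by rewrite integral_indic// setIT.
Qed.

Lemma aeRdP (R : realType) (n : nat)
    (mu : {measure set (n.-tuple R) -> \bar R}) (P : n.-tuple R -> Prop) :
  represents_intRd mu -> aeRd P <-> {ae mu, forall x, P x}.
Proof.
move=> muE; split=> [[N [[mN N0] NP]]|[N [mN N0 PN]]].
  exists N; split => //; first by rewrite -(represents_intRd_lebRd muE mN).
  by move=> x /= Px; apply: contrapT => /NP.
exists N; split; first by split => //; rewrite (represents_intRd_lebRd muE mN).
by move=> x Nx; apply: contrapT => Px; apply: Nx; exact: PN.
Qed.

Lemma measurable_cube (R : realType) (n : nat) (a : n.-tuple R) (l : R) :
  measurable (cube a l).
Proof.
rewrite (_ : cube a l = \bigcap_(i in [set: 'I_n])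
    ((@tnth n R)^~ i @^-1` `[tnth a i, (tnth a i + l)%R]%classic)).
  apply: fin_bigcap_measurable; first exact: finite_finset.
  move=> i _; rewrite -[X in measurable X]setTI.
  by apply: measurable_tnth => //; exact: measurable_itv.
apply/seteqP; split => [x xa i _ | x xa i].
  by rewrite /= in_itv /=; exact: xa.
by have := xa i I; rewrite /= in_itv.
Qed.

Lemma cube_cons (R : realType) (n : nat) (a : n.+1.-tuple R) (l x : R)
    (t : n.-tuple R) :
  cube a l (cons_tuple x t) <->
  (thead a <= x <= thead a + l)%R /\ cube [tuple of behead a] l t.
Proof.
split=> [H|[H0 H] i].
  split; first by have := H ord0; rewrite tnth0.
  move=> i; have := H (lift ord0 i); rewrite tnthS.
  by rewrite [a in tnth a _]tuple_eta tnthS.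
have [->|] := eqVneq i ord0; first by rewrite tnth0.
case: (unliftP ord0 i) => [j ->|-> /eqP//] _.
by rewrite tnthS [a in tnth a _]tuple_eta tnthS; exact: H.
Qed.

Lemma lebRd_cube (R : realType) (n : nat) (a : n.-tuple R) (l : R) :
  (0 <= l)%R -> lebRd (cube a l) = (l ^+ n)%:E.
Proof.
move=> l0; elim: n a => [a|n IH a].
  rewrite /lebRd /= expr0 indicE mem_set// => -[].
  by [].
rewrite /lebRd /=.
have [mu muE] := intRd_measure R n.
pose I : set R := `[thead a, (thead a + l)%R]%classic.
transitivity (\int[@lebesgue_measure R]_x ((\1_I x)%:E * (l ^+ n)%:E)).
  apply: eq_integral => x _.
  rewrite -/(@intRd R n (fun t => (\1_(cube a l) (cons_tuple x t))%:E)).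
  transitivity (@intRd R n (fun t =>
      (\1_I x)%:E * (\1_(cube [tuple of behead a] l) t)%:E)).
    congr intRd; apply/funext => t; rewrite -EFinM; congr EFin.
    rewrite !indicE -natrM mulnb; congr ((_ : bool)%:R).
    apply/idP/andP; rewrite !inE.
      by move/cube_cons => [H1 H2]; split => //; rewrite /I /= in_itv.
    by move=> [H1 H2]; apply/cube_cons; move: H1; rewrite /I /= in_itv.
  have m1 : measurable_fun setT
      (fun t : n.-tuple R => (\1_(cube [tuple of behead a] l) t : R)%:E).
    by apply/measurable_EFinP/measurable_indic; exact: measurable_cube.
  rewrite muE.
  - rewrite ge0_integralZl// ?lee_fin//.
    rewrite -muE//.
    by congr (_ * _); exact: IH.
  - by move=> t; rewrite mule_ge0// lee_fin.
  - exact: measurable_funeM.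
have mI : measurable I by exact: measurable_itv.
rewrite ge0_integralZr//.
- rewrite integral_indic// setIT.
  transitivity (l%:E * (l ^+ n)%:E); last by rewrite -EFinM exprS.
  congr (_ * _); apply: etrans (lebesgue_measure_itv _) _; rewrite /= lte_fin ltrDl.
  case: ltP => [_|l0']; first by rewrite -EFinD addrAC subrr add0r.
  by congr EFin; apply/le_anti; rewrite l0 l0'.
- exact/measurable_EFinP/measurable_indic.
- by rewrite lee_fin exprn_ge0.
Qed.

(** The set [-(N+1), N+1]^n. It is itself a [cube], so that its averages compete in [HLmax], and the
    successor keeps its side positive at N = 0. *)
Definition box (R : realType) (n : nat) (N : nat) : set (n.-tuple R) :=
  cube [tuple (- N.+1%:R)%R | i < n] (N.+1%:R *+ 2)%R.
Arguments box : clear implicits.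

Lemma boxP (R : realType) (n N : nat) (x : n.-tuple R) :
  box R n N x <-> forall i, (`|tnth x i| <= N.+1%:R)%R.
Proof.
rewrite /box /cube /=; split=> H i; have := H i.
  by rewrite tnth_mktuple ler_norml mulr2n addrA addNr add0r.
by rewrite tnth_mktuple ler_norml mulr2n addrA addNr add0r.
Qed.

Lemma measurable_box (R : realType) (n N : nat) : measurable (box R n N).
Proof. exact: measurable_cube. Qed.

Lemma box_nd (R : realType) (n i j : nat) :
  (i <= j)%N -> box R n i `<=` box R n j.
Proof.
move=> ij x /boxP xi; apply/boxP => k.
by rewrite (le_trans (xi k))// ler_nat ltnS.
Qed.

Lemma bigcup_box (R : realType) (n : nat) : \bigcup_N box R n N = setT.
Proof.
rewrite -subTset => x _.
exists (Num.truncn (\sum_(i < n) `|tnth x i|)%R) => //; apply/boxP => i.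
apply: ltW; apply: le_lt_trans (truncnS_gt _).
by rewrite (bigD1 i)//= lerDl sumr_ge0.
Qed.

Lemma measure_box_gt0 (R : realType) (n N : nat)
    (mu : {measure set (n.-tuple R) -> \bar R}) :
  represents_intRd mu -> 0 < mu (box R n N).
Proof.
move=> muE; rewrite -(represents_intRd_lebRd muE); last exact: measurable_box.
by rewrite lebRd_cube ?lte_fin ?exprn_gt0// ?mulrn_wgt0// mulrn_wge0.
Qed.

(** * Reduction of the maximal operator to rational cubes *)

(** Codes of no pair, or of a nonpositive side, give the empty set and weight 0, which add nothing
    to a maximum starting from 0. *)
Definition rat_cube (R : realType) (n : nat) (k : nat) : set (n.-tuple R) :=
  if (unpickle k : option (n.-tuple rat * rat)) is Some (a, l) then
    if (0 < l)%R then cube [tuple ratr (tnth a i) | i < n] (ratr l) else set0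
  else set0.
Arguments rat_cube : clear implicits.

Definition rat_cube_weight (R : realType) (n : nat) (k : nat) : R :=
  if (unpickle k : option (n.-tuple rat * rat)) is Some (_, l) then
    if (0 < l)%R then ((ratr l ^+ n)^-1)%R else 0%R
  else 0%R.
Arguments rat_cube_weight : clear implicits.

Lemma measurable_rat_cube (R : realType) (n k : nat) :
  measurable (rat_cube R n k).
Proof.
rewrite /rat_cube; case: unpickle => [[a l]|//].
by case: ifP => // _; exact: measurable_cube.
Qed.

Lemma rat_cube_weight_ge0 (R : realType) (n k : nat) :
  (0 <= rat_cube_weight R n k)%R.
Proof.
rewrite /rat_cube_weight; case: unpickle => [[a l]|//].
by case: ifP => // l0; rewrite invr_ge0 exprn_ge0// ler0q ltW.
Qed.

(** The rational cube is taken larger than the given one, so it still contains the point and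
    integrates at least as much; only the volume changes, by a factor at most 1/r. *)
Lemma rat_cube_approx (R : realType) (n : nat) (a : n.-tuple R) (l r : R) :
  (0 < l)%R -> (0 < r < 1)%R ->
  exists k, cube a l `<=` rat_cube R n k /\
            (r * (l ^+ n)^-1 <= rat_cube_weight R n k)%R.
Proof.
move=> l0 /andP[r0 r1].
have ln0 : (0 < l ^+ n)%R by rewrite exprn_gt0.
have : \forall y \near l, (y ^+ n < r^-1 * l ^+ n)%R.
  apply: (@exprn_continuous R n l [set z | (z < r^-1 * l ^+ n)%R]).
  apply: lt_nbhsl; rewrite -[ltLHS]mul1r ltr_pM2r//.
  by rewrite invf_gt1.
move=> /nbhs_ballP[e /= e0 He].
(* The corner moves down by less than e/3 and the side grows by between e/3 and 2e/3: the far faces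
   do not retreat, and the new side stays within e of [l]. *)
have e3 : (0 < e / 3)%R by rewrite divr_gt0.
have [l' /[!in_itv]/= /andP[l'1 l'2]] : exists q : rat,
    ratr q \in `](l + e / 3)%R, (l + e / 3 + e / 3)%R[.
  by apply: rat_in_itvoo; rewrite ltrDl.
have Ha i : exists q : rat, ratr q \in `](tnth a i - e / 3)%R, (tnth a i)[.
  by apply: rat_in_itvoo; rewrite ltrBlDr ltrDl.
pose a' : n.-tuple rat := [tuple xchoose (Ha i) | i < n].
have l'0 : (0 < l')%R.
  by rewrite -(@ltr0q R); apply: le_lt_trans l'1; rewrite addr_ge0// ltW.
exists (pickle (a', l')).
rewrite /rat_cube /rat_cube_weight pickleK l'0; split.
  move=> y ya i; rewrite !tnth_mktuple.
  have := xchooseP (Ha i); rewrite in_itv /= => /andP[q1 q2].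
  have /andP[y1 y2] := ya i.
  rewrite (le_trans (ltW q2) y1) /= (le_trans y2)//.
  have : (tnth a i - e / 3 + (l + e / 3) <= ratr (xchoose (Ha i)) + ratr l')%R.
    by apply: lerD; exact: ltW.
  by rewrite addrACA addNr addr0.
rewrite -[r]invrK -invfM lef_pV2 ?posrE ?mulr_gt0 ?invr_gt0//; last first.
  by rewrite exprn_gt0// ltr0q.
apply/ltW/He; rewrite /ball /= distrC ger0_norm; last lra.
by lra.
Qed.

(** Equality holds at every point. An arbitrary average, multiplied by any r < 1, is below some
    rational one, and r can tend to 1; conversely every rational cube of positive side is admissible
    in [HLmax]. *)
Lemma HLmaxE (R : realType) (n : nat)
    (mu : {measure set (n.-tuple R) -> \bar R}) (f : n.-tuple R -> R) :
  represents_intRd mu -> measurable_fun setT f ->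
  HLmax f = sup_op mu (rat_cube R n) (rat_cube_weight R n)
    (fun y => (`|f y|)%:E).
Proof.
move=> muE mf; apply/funext => x.
have mcube A : measurable A ->
    measurable_fun setT (fun y => (`|f y|)%:E * (\1_A y : R)%:E).
  move=> mA; apply: emeasurable_funM; first exact/measurable_EFinP/measurableT_comp.
  exact/measurable_EFinP/measurable_indic.
have intE A : measurable A -> intRd (fun y => (`|f y| * (\1_A y : R))%:E) =
    \int[mu]_y ((`|f y|)%:E * (\1_A y)%:E).
  move=> mA; rewrite muE => [|y|].
  - by apply: eq_integral => y _; rewrite EFinM.
  - by rewrite lee_fin mulr_ge0.
  - exact: mcube.
(* The base value 0 of [max_op] must also lie below [HLmax f x]; the unit cube with corner [x] shows
   that the supremum is over a nonempty family. *)
have HL0 : 0 <= HLmax f x.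
  apply: (@le_trans _ _ (((1 ^+ n)^-1)%:E *
      intRd (fun y => (`|f y| * (\1_(cube x 1) y : R))%:E))).
    rewrite mule_ge0 ?lee_fin ?expr1n ?invr1//.
    rewrite intE; last exact: measurable_cube.
    by apply: integral_ge0 => y _; rewrite mule_ge0// lee_fin.
  apply: ereal_sup_ubound; exists x, 1%R; split => //.
  by move=> i; rewrite lexx lerDl ler01.
apply/eqP; rewrite eq_le; apply/andP; split.
  apply: ge_ereal_sup => _ [a [l [l0 xa ->]]].
  rewrite intE; last exact: measurable_cube.
  set I := (X in _ * X).
  have I0 : 0 <= I by apply: integral_ge0 => y _; rewrite mule_ge0// lee_fin.
  apply/lee_mul01Pr.
    by rewrite mule_ge0// lee_fin invr_ge0 exprn_ge0// ltW.
  move=> r r01; have [k [ak rk]] := rat_cube_approx a l0 r01.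
  apply: le_trans (max_op_le_sup_op _ _ _ k.+1 _ _).
  rewrite /= le_max; apply/orP; right.
  rewrite /avg_op indicE mem_set; last exact: ak.
  rewrite mule1 muleA -EFinM; apply: lee_pmul => //.
  - by rewrite lee_fin mulr_ge0 ?invr_ge0 ?exprn_ge0// ltW//; case/andP: r01.
  - apply: ge0_le_integral => //.
    + by apply: mcube; exact: measurable_cube.
    + by apply: mcube; exact: measurable_rat_cube.
    + move=> y _; rewrite lee_wpmul2l ?lee_fin// !indicE ler_nat.
      have [/set_mem/ak/mem_set -> //|_] := boolP (y \in cube a l).
      by rewrite leq0n.
apply: ge_ereal_sup => _ [k _ <-].
elim: k => [//|k IH] /=; rewrite ge_max IH /=.
rewrite indicE; have [xk|_] := boolP (x \in _); last by rewrite mule0.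
rewrite mule1; move: xk; rewrite inE /avg_op /rat_cube /rat_cube_weight.
case: unpickle => [[a l]|//]; case: ifP => // l0 xa.
apply: ereal_sup_ubound.
exists [tuple ratr (tnth a i) | i < n], (ratr l); split => //; first by rewrite ltr0q.
by rewrite intE//; exact: measurable_cube.
Qed.

(** * Almost everywhere criteria and boxes in X and X' *)

Lemma ae_lty_box (R : realType) (n : nat)
    (mu : {measure set (n.-tuple R) -> \bar R}) (h : n.-tuple R -> \bar R) :
  (forall x, 0 <= h x) -> measurable_fun setT h ->
  (forall N, \int[mu]_x ((\1_(box R n N) x)%:E * h x) < +oo) ->
  {ae mu, forall x, h x < +oo}.
Proof.
move=> h0 mh hN.
have /ae_foralln : forall N, {ae mu, forall x, setT x ->
    (\1_(box R n N) x)%:E * h x \is a fin_num}.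
  move=> N; apply: integrable_ae => //; apply/integrableP; split.
    apply: emeasurable_funM => //; apply/measurable_EFinP/measurable_indic.
    exact: measurable_box.
  under eq_integral do rewrite gee0_abs ?mule_ge0 ?lee_fin//.
  exact: hN.
apply: filterS => x xN.
have [N _ xbN] : (\bigcup_N box R n N) x by rewrite bigcup_box.
have := xN N I; rewrite indicE mem_set// mul1e ge0_fin_numE//.
Qed.

Lemma ae_eq0_box (R : realType) (n : nat)
    (mu : {measure set (n.-tuple R) -> \bar R}) (h : n.-tuple R -> \bar R) :
  (forall x, 0 <= h x) -> measurable_fun setT h ->
  (forall N, \int[mu]_x ((\1_(box R n N) x)%:E * h x) = 0) ->
  {ae mu, forall x, h x = 0}.
Proof.
move=> h0 mh hN.
have /ae_foralln : forall N, {ae mu, forall x, setT x ->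
    (\1_(box R n N) x)%:E * h x = 0}.
  move=> N; apply/ae_eq_integral_abs => //.
    apply: emeasurable_funM => //; apply/measurable_EFinP/measurable_indic.
    exact: measurable_box.
  under eq_integral do rewrite gee0_abs ?mule_ge0 ?lee_fin//.
  exact: hN.
apply: filterS => x xN.
have [N _ xbN] : (\bigcup_N box R n N) x by rewrite bigcup_box.
by have := xN N I; rewrite indicE mem_set// mul1e.
Qed.

Lemma intRd_absM (R : realType) (n : nat)
    (mu : {measure set (n.-tuple R) -> \bar R}) (f g : n.-tuple R -> R) :
  represents_intRd mu -> measurable_fun setT f -> measurable_fun setT g ->
  intRd (fun x => (`|f x * g x|)%:E) =
  \int[mu]_x ((`|f x|)%:E * (`|g x|)%:E).
Proof.
move=> muE mf mg; rewrite muE => [|x|].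
- by apply: eq_integral => x _; rewrite normrM EFinM.
- by rewrite lee_fin.
- apply/measurable_EFinP; apply: measurableT_comp => //.
  exact: measurable_funM.
Qed.

Lemma measurable_EFin_abs (d : measure_display) (T : measurableType d)
    (R : realType) (f : T -> R) :
  measurable_fun setT f -> measurable_fun setT (fun x => (`|f x|)%:E).
Proof. by move=> mf; apply/measurable_EFinP; exact: measurableT_comp. Qed.

Lemma measurable_EFin_box (R : realType) (n N : nat) :
  measurable_fun setT (fun x => (\1_(box R n N) x : R)%:E).
Proof. by apply/measurable_EFinP/measurable_indic; exact: measurable_box. Qed.

(** Used in two directions: as a uniform lower bound for the maximal function on a box, and as a
    proof of integrability on a box from finiteness of [HLmax f] at one point. *)
Lemma HLmax_box (R : realType) (n N : nat)
    (mu : {measure set (n.-tuple R) -> \bar R}) (f : n.-tuple R -> R) (x : n.-tuple R) :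
  represents_intRd mu -> measurable_fun setT f -> box R n N x ->
  (((N.+1%:R *+ 2) ^+ n)^-1)%:E *
    \int[mu]_y ((\1_(box R n N) y)%:E * (`|f y|)%:E) <= HLmax f x.
Proof.
move=> muE mf xN; apply: ereal_sup_ubound.
exists [tuple (- N.+1%:R)%R | i < n], (N.+1%:R *+ 2)%R; split => //.
congr (_ * _); rewrite muE => [|y|].
- by apply: eq_integral => y _; rewrite EFinM muleC.
- by rewrite lee_fin mulr_ge0.
- apply/measurable_EFinP; apply: measurable_funM; first exact: measurableT_comp.
  by apply: measurable_indic; exact: measurable_box.
Qed.

(** Saturation yields one set [F] of positive measure with indicator in X. On any box large enough
    to meet [F], M 1_F exceeds a positive constant, so the ideal property gives the indicator of the
    box. *)
Lemma box_in_QBFS (R : realType) (n : nat)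
    (mu : {measure set (n.-tuple R) -> \bar R})
    (X : set (n.-tuple R -> R)) (nrm : (n.-tuple R -> R) -> R) (C : R) :
  represents_intRd mu -> is_QBFS X nrm ->
  M_bounded X (fun f => (nrm f)%:E) C ->
  forall N, X (\1_(box R n N)).
Proof.
move=> muE [Xm [_ [_ [XZ [_ [_ [_ [_ [_ [ideal sat]]]]]]]]]] MX N.
have [||F [mF _ F0 XF]] := sat setT; first exact: measurableT.
  rewrite (represents_intRd_lebRd muE)//.
  apply: lt_le_trans (measure_box_gt0 0 muE) _.
  by rewrite le_measure ?inE//; exact: measurable_box.
have [fin XM _] := MX _ XF.
have mF1 : measurable_fun setT (fun x => (`|\1_F x : R|)%:E).
  by apply: measurable_EFin_abs; exact: measurable_indic.
have [N0 IN0] : exists N0,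
    0 < \int[mu]_x ((\1_(box R n N0) x)%:E * (`|\1_F x|)%:E).
  apply/not_existsP => H; move: F0.
  rewrite (represents_intRd_lebRd muE)//.
  rewrite -(setIT F) -integral_indic//.
  have : {ae mu, forall x, (`|\1_F x : R|)%:E = 0}.
    apply: ae_eq0_box => // k; apply/eqP; rewrite eq_le leNgt.
    by rewrite (introN idP (H k)) integral_ge0.
  move=> ae0.
  rewrite (@ge0_ae_eq_integral _ _ _ _ _ _ (cst 0)) ?integral_cst ?mul0e ?ltxx//.
  - exact/measurable_EFinP/measurable_indic.
  - by apply: filterS ae0 => x /eqP; rewrite eqe normr_eq0 => /eqP ->.
(* One box that both contains [box R n N] and meets [F] in positive measure. *)
pose M := maxn N N0.
have IM : 0 < \int[mu]_x ((\1_(box R n M) x)%:E * (`|\1_F x|)%:E).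
  apply: lt_le_trans IN0 _; apply: ge0_le_integral => //.
  - by apply: emeasurable_funM => //; exact: measurable_EFin_box.
  - by apply: emeasurable_funM => //; exact: measurable_EFin_box.
  - move=> x _; rewrite lee_wpmul2r// lee_fin !indicE ler_nat.
    have [/set_mem xN0|_] := boolP (x \in box R n N0); last by rewrite leq0n.
    by rewrite mem_set//; apply: box_nd xN0; exact: leq_maxr.
set v := (((M.+1%:R *+ 2) ^+ n)^-1)%:E *
    \int[mu]_x ((\1_(box R n M) x)%:E * (`|\1_F x : R|)%:E).
have v0 : 0 < v.
  by rewrite mule_gt0// lte_fin invr_gt0 exprn_gt0// mulrn_wgt0.
(* Any positive real below [v] serves as the constant, so [v] need not be shown finite. *)
have [r r0 rv] : exists2 r : R, (0 < r)%R & r%:E <= v.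
  case: v v0 => [r| |//] r0; first by exists r.
  by exists 1%R => //; rewrite leey.
have Xr := XZ r^-1%R _ XM.
have [||XN _ //] := ideal _ (\1_(box R n N)) Xr.
  by apply: measurable_indic; exact: measurable_box.
(* The null set where the maximal function is infinite is discarded, because [fine] sends +oo to 0
   and would break the lower bound there. *)
case: fin => Z [Z0 ZP]; exists Z; split => // x /ZP Mx.
rewrite indicE; have [/set_mem xN|_] := boolP (x \in _); last first.
  by rewrite normr0.
rewrite normr1 ger0_norm; last first.
  rewrite mulr_ge0// ?invr_ge0 ?(ltW r0)// fine_ge0//.
  by rewrite (HLmaxE muE (Xm _ XF)) sup_op_ge0.
rewrite ler_pdivlMl// mulr1 -lee_fin /= fineK; last first.
  rewrite ge0_fin_numE// (HLmaxE muE (Xm _ XF)); exact: sup_op_ge0.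
apply: le_trans rv _; apply: (HLmax_box muE (Xm _ XF)).
by apply: box_nd xN; exact: leq_maxl.
Qed.

(** For [f] in X, [HLmax f] is finite a.e., hence at some point of the box since the box has
    positive measure; that single value bounds the integral of |f| over the box. *)
Lemma box_in_kothe (R : realType) (n : nat)
    (mu : {measure set (n.-tuple R) -> \bar R})
    (X : set (n.-tuple R -> R)) (nrm : (n.-tuple R -> R) -> R) (C : R) :
  represents_intRd mu -> is_QBFS X nrm ->
  M_bounded X (fun f => (nrm f)%:E) C ->
  forall N, kothe X (\1_(box R n N)).
Proof.
move=> muE [Xm _] MX N.
have mb : measurable_fun setT (\1_(box R n N) : _ -> R).
  by apply: measurable_indic; exact: measurable_box.
split => // f Xf; have mf := Xm _ Xf.
have [fin _ _] := MX _ Xf.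
have [x xN xfin] : exists2 x, box R n N x & HLmax f x < +oo.
  apply: contrapT => H; have := measure_box_gt0 N muE.
  case/(aeRdP _ muE): fin => Z [mZ Z0 ZP].
  rewrite ltNge -Z0 le_measure ?inE//; first exact: measurable_box.
  by move=> x xN; apply: ZP => /= xfin; apply: H; exists x.
rewrite (intRd_absM muE)//.
under eq_integral do rewrite muleC [X in X%:E * _]ger0_norm//.
have := le_lt_trans (HLmax_box muE mf xN) xfin.
set I := \int[mu]_y _ => cI.
rewrite ltNge leye_eq; apply/negP => /eqP Ioo; move: cI.
by rewrite Ioo gt0_muley// lte_fin invr_gt0 exprn_gt0// mulrn_wgt0.
Qed.

(** * Pairings between X, X' and X'' *)

(** Adjoints and series take values in the extended reals, while elements of X' are real-valued.
    Testing [h] on boxes, whose indicators are in X, shows that [fine] alters it only on a null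
    set. *)
Lemma kothe_fine (R : realType) (n : nat)
    (mu : {measure set (n.-tuple R) -> \bar R})
    (X : set (n.-tuple R -> R)) (nrm : (n.-tuple R -> R) -> R) (C : R)
    (h : n.-tuple R -> \bar R) :
  represents_intRd mu -> is_QBFS X nrm ->
  M_bounded X (fun f => (nrm f)%:E) C ->
  (forall x, 0 <= h x) -> measurable_fun setT h ->
  (forall f, X f -> \int[mu]_x ((`|f x|)%:E * h x) < +oo) ->
  kothe X (fine \o h) /\
  forall f : n.-tuple R -> R, measurable_fun setT f ->
    intRd (fun x => (`|f x * (fine \o h) x|)%:E) =
    \int[mu]_x ((`|f x|)%:E * h x).
Proof.
move=> muE QX MX h0 mh hX.
have mfh : measurable_fun setT (fine \o h).
  by apply: measurableT_comp => //; exact: fine_measurable.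
have hfin : {ae mu, forall x, h x < +oo}.
  apply: ae_lty_box => // N; have := hX _ (box_in_QBFS muE QX MX N).
  by under eq_integral do rewrite ger0_norm//.
have hE (f : n.-tuple R -> R) : measurable_fun setT f ->
    intRd (fun x => (`|f x * (fine \o h) x|)%:E) =
    \int[mu]_x ((`|f x|)%:E * h x).
  move=> mf; rewrite (intRd_absM muE)//; apply: ge0_ae_eq_integral => //.
  - by apply: emeasurable_funM; exact: measurable_EFin_abs.
  - by apply: emeasurable_funM => //; exact: measurable_EFin_abs.
  - by move=> x _; rewrite mule_ge0.
  - apply: filterS hfin => x hx _ /=.
    by congr (_ * _); rewrite ger0_norm ?fine_ge0// fineK// ge0_fin_numE.
split => //; split => // f Xf.
by rewrite hE; [exact: hX|exact: QX.1].
Qed.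

Lemma kothe_pairing_le (R : realType) (n : nat)
    (mu : {measure set (n.-tuple R) -> \bar R})
    (X : set (n.-tuple R -> R)) (nrm : (n.-tuple R -> R) -> R)
    (f g : n.-tuple R -> R) :
  represents_intRd mu -> is_QBFS X nrm -> X f -> kothe X g ->
  kothe_norm X (fun f => (nrm f)%:E) g <= 1 ->
  intRd (fun x => (`|f x * g x|)%:E) <= (nrm f)%:E.
Proof.
move=> muE [Xm [_ [_ [XZ [nge0 [n0 [nZ _]]]]]]] Xf [mg _] g1.
have mf := Xm _ Xf.
rewrite (intRd_absM muE)//.
have mfg : measurable_fun setT (fun x => (`|f x|)%:E * (`|g x|)%:E).
  by apply: emeasurable_funM; exact: measurable_EFin_abs.
(* The Köthe norm tests only functions of norm exactly 1, so norm 0 cannot be reached by scaling;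
   there [f] vanishes a.e. *)
have [f0|f0] := eqVneq (nrm f) 0%R.
  have /(aeRdP _ muE) aef := (n0 _ Xf).1 f0.
  rewrite f0 (@ge0_ae_eq_integral _ _ _ _ _ _ (cst 0)) ?integral_cst ?mul0e//.
  by apply: filterS aef => x -> _ /=; rewrite normr0 mul0e.
have fgt0 : (0 < nrm f)%R by rewrite lt_neqAle eq_sym f0 nge0.
have Xu := XZ (nrm f)^-1%R _ Xf.
have u1 : nrm (fun x => (nrm f)^-1 * f x)%R = 1%R.
  by rewrite nZ// ger0_norm ?invr_ge0 ?nge0// mulVf.
have : intRd (fun x => (`|(nrm f)^-1 * f x * g x|)%:E) <= 1.
  apply: le_trans g1; apply: ereal_sup_ubound; right.
  by exists (fun x => (nrm f)^-1 * f x)%R => //=; split => //; rewrite u1.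
rewrite (intRd_absM muE (Xm _ Xu))//.
under eq_integral do rewrite normrM EFinM -muleA.
rewrite ge0_integralZl// ?lee_fin// ger0_norm ?invr_ge0 ?nge0//.
by rewrite -(@lee_pmul2l _ (nrm f)%:E) ?lte_fin// muleA -EFinM divff// mul1e mule1.
Qed.

Lemma kothe_normZ (R : realType) (n : nat)
    (mu : {measure set (n.-tuple R) -> \bar R})
    (X : set (n.-tuple R -> R)) (nrm : (n.-tuple R -> R) -> R)
    (g : n.-tuple R -> R) (c : R) :
  represents_intRd mu -> is_QBFS X nrm -> kothe X g -> (0 < c)%R ->
  kothe X (fun x => c * g x)%R /\
  kothe_norm X (fun f => (nrm f)%:E) (fun x => c * g x)%R =
  c%:E * kothe_norm X (fun f => (nrm f)%:E) g.
Proof.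
move=> muE [Xm _] [mg gX] c0.
have mcg : measurable_fun setT (fun x => c * g x)%R by exact: measurable_funM.
have cE (f : n.-tuple R -> R) : measurable_fun setT f ->
    intRd (fun x => (`|f x * (c * g x)|)%:E) =
    c%:E * intRd (fun x => (`|f x * g x|)%:E).
  move=> mf; rewrite (intRd_absM muE)// (intRd_absM muE)// -ge0_integralZl//.
  - by apply: eq_integral => x _; rewrite normrM EFinM muleCA (gtr0_norm c0).
  - by apply: emeasurable_funM; exact: measurable_EFin_abs.
  - by rewrite lee_fin ltW.
split.
  split => // f Xf; rewrite cE; last exact: Xm.
  by rewrite lte_mul_pinfty ?lee_fin ?(ltW c0)//; exact: gX.
rewrite /kothe_norm -ereal_sup_pZl//; congr ereal_sup.
apply/seteqP; split => [y [->|[f [Xf f1] <-]]|_ [y [->|[f [Xf f1] <-]] <-]].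
- by exists 0; [left|rewrite mule0].
- exists (intRd (fun x => (`|f x * g x|)%:E)); first by right; exists f.
  by rewrite cE//; exact: Xm.
- by left; rewrite mule0.
- by right; exists f => //; rewrite cE//; exact: Xm.
Qed.

(** Hölder between X' and X'' by normalizing [h]. The real bound [D] makes the norm of [h] finite,
    as scaling requires, while the norm of [f] is allowed to be +oo. *)
Lemma kothe_bidual_pairing_le (R : realType) (n : nat)
    (mu : {measure set (n.-tuple R) -> \bar R})
    (X : set (n.-tuple R -> R)) (nrm : (n.-tuple R -> R) -> R) (C : R)
    (f h : n.-tuple R -> R) (D : R) :
  represents_intRd mu -> is_QBFS X nrm ->
  M_bounded X (fun f => (nrm f)%:E) C ->
  kothe (kothe X) f -> kothe X h ->
  kothe_norm X (fun f => (nrm f)%:E) h <= D%:E ->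
  intRd (fun x => (`|f x * h x|)%:E) <=
  D%:E * kothe_norm (kothe X) (kothe_norm X (fun f => (nrm f)%:E)) f.
Proof.
move=> muE QX MX [mf fX] Xh hD; have [mh hX] := Xh.
set nf := kothe_norm (kothe X) _ f.
have nf0 : 0 <= nf by apply: ereal_sup_ubound; left.
set nh := kothe_norm X _ h in hD.
have nh0 : 0 <= nh by apply: ereal_sup_ubound; left.
have mhE := measurable_EFin_abs mh.
(* Here [D] may be 0, so the pairing itself has to vanish. Normalized indicators of boxes, available
   in X, show that [h] is 0 a.e. *)
have [nh_eq0|nh_neq0] := eqVneq nh 0.
  have D0 : 0 <= D%:E by rewrite -nh_eq0.
  rewrite (intRd_absM muE)//.
  suff h0 : {ae mu, forall x, (`|h x|)%:E = 0}.
    rewrite (@ge0_ae_eq_integral _ _ _ _ _ _ (cst 0)) ?integral_cst ?mul0e ?mule_ge0//.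
    - by apply: emeasurable_funM => //; exact: measurable_EFin_abs.
    - by apply: filterS h0 => x -> _ /=; rewrite mule0.
  apply: ae_eq0_box => // N.
  have XB := box_in_QBFS muE QX MX N.
  have mB : measurable_fun setT (fun x => (\1_(box R n N) x : R)%:E).
    exact: measurable_EFin_box.
  case: QX => [Xm [_ [_ [XZ [nge0 [n0 [nZ _]]]]]]].
  have B0 : nrm (\1_(box R n N)) != 0%R.
    apply/eqP => /(n0 _ XB) /(aeRdP _ muE)[Z [mZ Z0 BZ]].
    have := measure_box_gt0 N muE; rewrite ltNge -Z0 le_measure ?inE//.
      exact: measurable_box.
    move=> x xB; apply: BZ => /=; rewrite indicE mem_set//.
    by apply/eqP; rewrite oner_eq0.
  set b := nrm _ in B0.
  have b0 : (0 < b)%R by rewrite lt_neqAle eq_sym B0 nge0.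
  have Xu := XZ b^-1%R _ XB.
  have : intRd (fun x => (`|b^-1 * \1_(box R n N) x * h x|)%:E) <= 0.
    rewrite -nh_eq0; apply: ereal_sup_ubound; right.
    exists (fun x => b^-1 * \1_(box R n N) x)%R => //=; split => //.
    by rewrite nZ// ger0_norm ?invr_ge0 ?(ltW b0)// mulVf.
  rewrite (intRd_absM muE (Xm _ Xu))//.
  under eq_integral do rewrite normrM EFinM -muleA [X in _ * (X%:E * _)]ger0_norm//.
  rewrite ge0_integralZl//; last exact: emeasurable_funM.
  rewrite pmule_rle0; last by rewrite lte_fin normr_gt0 invr_eq0.
  by move=> H; apply/eqP; rewrite eq_le H integral_ge0.
have nh_gt0 : 0 < nh by rewrite lt_neqAle eq_sym nh_neq0.
have nhfin : nh \is a fin_num.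
  by rewrite ge0_fin_numE// (le_lt_trans hD)// ltry.
pose r := fine nh.
have rE : nh = r%:E by rewrite fineK.
have r0 : (0 < r)%R by rewrite -lte_fin -rE.
have rV0 : (0 < r^-1)%R by rewrite invr_gt0.
have [Xu uE] := kothe_normZ muE QX Xh rV0.
have : intRd (fun x => (`|r^-1 * h x * f x|)%:E) <= nf.
  apply: ereal_sup_ubound; right.
  exists (fun x => r^-1 * h x)%R => //; split => //.
  by rewrite uE -/nh rE -EFinM mulVf// gt_eqF.
rewrite (intRd_absM muE Xu.1)//.
under eq_integral do rewrite normrM EFinM -muleA.
rewrite ge0_integralZl//; last first.
  by apply: emeasurable_funM => //; exact: measurable_EFin_abs.
rewrite gtr0_norm// => H.
rewrite (intRd_absM muE)//.
apply: (@le_trans _ _ (r%:E * nf)); last first.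
  by rewrite lee_wpmul2r// -rE.
under eq_integral do rewrite muleC.
move: H; rewrite -(@lee_pmul2l _ r%:E) ?lte_fin//.
by rewrite muleA -EFinM divff ?gt_eqF// mul1e.
Qed.

(** * The maximal operator paired with X' *)

Lemma integral_HLmax_fine (R : realType) (n : nat)
    (mu : {measure set (n.-tuple R) -> \bar R}) (f g : n.-tuple R -> R) :
  represents_intRd mu -> measurable_fun setT f -> measurable_fun setT g ->
  aeRd (fun x => HLmax f x < +oo) ->
  intRd (fun x => (`|(fine \o HLmax f) x * g x|)%:E) =
  \int[mu]_x ((`|g x|)%:E * HLmax f x).
Proof.
move=> muE mf mg /(aeRdP _ muE) fin.
have mM : measurable_fun setT (HLmax f).
  by rewrite (HLmaxE muE mf); apply: measurable_sup_op; exact: measurable_rat_cube.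
have M0 x : 0 <= HLmax f x by rewrite (HLmaxE muE mf) sup_op_ge0.
have mfM : measurable_fun setT (fine \o HLmax f).
  by apply: measurableT_comp => //; exact: fine_measurable.
rewrite (intRd_absM muE)//; apply: ge0_ae_eq_integral => //.
- by apply: emeasurable_funM; exact: measurable_EFin_abs.
- by apply: emeasurable_funM => //; exact: measurable_EFin_abs.
- by move=> x _; rewrite mule_ge0.
- apply: filterS fin => x xfin _ /=; rewrite muleC; congr (_ * _).
  by rewrite ger0_norm ?fine_ge0// fineK// ge0_fin_numE.
Qed.

(* [h] is the adjoint, applied to [|g|], of a linearization at [f] of the
   maximum over the first [k] rational cubes. *)
Lemma HLmax_dual (R : realType) (n : nat)
    (mu : {measure set (n.-tuple R) -> \bar R}) (f g : n.-tuple R -> R) (k : nat) :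
  represents_intRd mu -> measurable_fun setT f -> measurable_fun setT g ->
  exists h : n.-tuple R -> \bar R,
    [/\ forall x, 0 <= h x, measurable_fun setT h,
     \int[mu]_x ((`|g x|)%:E * max_op mu (rat_cube R n) (rat_cube_weight R n) k
       (fun y => (`|f y|)%:E) x) = \int[mu]_x ((`|f x|)%:E * h x) &
     forall u : n.-tuple R -> R, measurable_fun setT u ->
       \int[mu]_x ((`|u x|)%:E * h x) <= \int[mu]_x ((`|g x|)%:E * HLmax u x)].
Proof.
move=> muE mf mg.
have mQ := @measurable_rat_cube R n.
have [h [h0 mh hf hle]] := @max_op_dual _ _ R mu _ _ k (fun x => (`|g x|)%:E)
  (fun x => (`|f x|)%:E) mQ (@rat_cube_weight_ge0 R n) (fun=> normr_ge0 _)
  (measurable_EFin_abs mg) (fun=> normr_ge0 _) (measurable_EFin_abs mf).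
exists h; split => // u mu_; apply: le_trans (hle _ _ _) _ => //.
  exact: measurable_EFin_abs.
rewrite (HLmaxE muE mu_); apply: ge0_le_integral => //.
- by move=> x _; rewrite mule_ge0// max_op_ge0.
- apply: emeasurable_funM; first exact: measurable_EFin_abs.
  exact: measurable_max_op.
- apply: emeasurable_funM; first exact: measurable_EFin_abs.
  exact: measurable_sup_op.
- by move=> x _; rewrite lee_wpmul2l//; exact: max_op_le_sup_op.
Qed.

(* If the integral diverged, a weighted sum of the functions of [HLmax_dual]
   along a subsequence of truncations would be an element of the Köthe dual
   whose pairing with [f] diverges. *)
Lemma integral_HLmax_bidual_lty (R : realType) (n : nat)
    (mu : {measure set (n.-tuple R) -> \bar R})
    (X : set (n.-tuple R -> R)) (nrm : (n.-tuple R -> R) -> R) (C : R)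
    (f g : n.-tuple R -> R) :
  represents_intRd mu -> is_QBFS X nrm ->
  M_bounded X (fun f => (nrm f)%:E) C ->
  kothe (kothe X) f -> kothe X g ->
  \int[mu]_x ((`|g x|)%:E * HLmax f x) < +oo.
Proof.
move=> muE QX MX [mf fX] [mg gX].
have Xm := QX.1.
rewrite ltNge leye_eq; apply/negP => /eqP Ioo.
have mQ := @measurable_rat_cube R n.
(* The factor [2 ^ j.+1] anticipates the weight of the j-th summand and leaves a contribution of at
   least j. Divergence of the integral makes every such threshold attainable by a finite maximum. *)
have Hj (j : nat) : exists h : n.-tuple R -> \bar R,
    [/\ forall x, 0 <= h x, measurable_fun setT h,
     (j%:R * (2 ^ j.+1)%:R)%:E <= \int[mu]_x ((`|f x|)%:E * h x) &
     forall u : n.-tuple R -> R, measurable_fun setT u ->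
       \int[mu]_x ((`|u x|)%:E * h x) <= \int[mu]_x ((`|g x|)%:E * HLmax u x)].
  have : (j%:R * (2 ^ j.+1)%:R)%:E < \int[mu]_x ((`|g x|)%:E * HLmax f x).
    by rewrite Ioo ltry.
  rewrite (HLmaxE muE mf) integral_sup_op//; last exact: measurableT_comp.
  move=> /ereal_sup_gt[_ [k _ <-] jk].
  have [h [h0 mh hf hle]] := HLmax_dual k muE mf mg.
  by exists h; split => //; rewrite -hf ltW.
have [h_ h_P] := choice Hj.
have h0 j x : 0 <= h_ j x by case: (h_P j).
have mh j : measurable_fun setT (h_ j) by case: (h_P j).
pose t j x := ((2 ^ j.+1)%:R^-1 : R)%:E * h_ j x.
have t0 j x : 0 <= t j x by rewrite mule_ge0// lee_fin.
have mt j : measurable_fun setT (t j) by exact: measurable_funeM.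
pose H x := \sum_(0 <= j <oo) t j x.
have H0 x : 0 <= H x by exact: nneseries_ge0.
have mH : measurable_fun setT H by exact: ge0_emeasurable_sum.
have pairE (u : n.-tuple R -> R) : measurable_fun setT u ->
    \int[mu]_x ((`|u x|)%:E * H x) =
    \sum_(0 <= j <oo) ((2 ^ j.+1)%:R^-1)%:E * \int[mu]_x ((`|u x|)%:E * h_ j x).
  move=> mu_; have muE_ := measurable_EFin_abs mu_.
  transitivity (\int[mu]_x \sum_(0 <= j <oo) (`|u x|)%:E * t j x).
    by apply: eq_integral => x _; rewrite nneseriesZl.
  rewrite integral_nneseries//; last 2 first.
  - by move=> j; exact: emeasurable_funM.
  - by move=> j x _; rewrite mule_ge0.
  apply: eq_eseriesr => j _; rewrite -ge0_integralZl//.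
  - by apply: eq_integral => x _; rewrite muleCA.
  - exact: emeasurable_funM.
  - by move=> x _; rewrite mule_ge0.
have [XH HE] : kothe X (fine \o H) /\
    forall u : n.-tuple R -> R, measurable_fun setT u ->
    intRd (fun x => (`|u x * (fine \o H) x|)%:E) =
    \int[mu]_x ((`|u x|)%:E * H x).
  apply: (kothe_fine muE QX MX) => // u Xu.
  have mu_ := Xm _ Xu; have [ufin XMu _] := MX _ Xu.
  rewrite pairE//; set B := \int[mu]_x ((`|g x|)%:E * HLmax u x).
  have Boo : B < +oo.
    by rewrite /B -(integral_HLmax_fine muE mu_ mg ufin); exact: gX.
  have B0 : 0 <= B.
    apply: integral_ge0 => x _; rewrite mule_ge0//.
    by rewrite (HLmaxE muE mu_) sup_op_ge0.
  have BE : B = (fine B)%:E by rewrite fineK// ge0_fin_numE.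
  apply: le_lt_trans (ltry (fine B)).
  (* Each [h_ j] pairs with [u] to at most [B], uniformly in j, and the weights 2^-(j+1) sum to
     1. *)
  apply: le_trans (epsilon_trick0 xpredT (fine_ge0 B0)).
  apply: lee_nneseries => [j _ _|j _].
    rewrite mule_ge0 ?lee_fin// integral_ge0// => x _.
    by rewrite mule_ge0.
  rewrite EFinM muleC lee_wpmul2r ?lee_fin// -BE.
  by have [_ _ _] := h_P j; exact.
have := fX _ XH.
under eq_fun do rewrite mulrC.
rewrite HE//; apply/negP; rewrite -leNgt.
(* The j-th summand alone is at least j, so the pairing of [f] with [H] exceeds every real. *)
suff Hge j : (j%:R : R)%:E <= \int[mu]_x ((`|f x|)%:E * H x).
  rewrite leye_eq; apply/eqP/eqyP => A A0.
  apply: le_trans (Hge (Num.truncn A).+1).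
  by rewrite lee_fin ltW// truncnS_gt.
rewrite pairE//.
set s := (X in X @ _); set S := limn _.
pose a i := ((2 ^ i.+1)%:R^-1 : R)%:E * \int[mu]_x ((`|f x|)%:E * h_ i x).
have a0 i : 0 <= a i.
  rewrite mule_ge0 ?lee_fin// integral_ge0// => x _.
  by rewrite mule_ge0.
apply: (@le_trans _ _ (a j)).
  have [_ _ jh _] := h_P j.
  apply: le_trans (_ : ((2 ^ j.+1)%:R^-1 : R)%:E * (j%:R * (2 ^ j.+1)%:R)%:E <= _).
    by rewrite -EFinM mulrCA mulVf ?mulr1// pnatr_eq0 -lt0n expn_gt0.
  by rewrite lee_wpmul2l// lee_fin.
apply: (@le_trans _ _ (\sum_(0 <= i < j.+1) a i)).
  by rewrite big_nat_recr//= leeDr// sume_ge0.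
exact: nneseries_lim_ge.
Qed.

Local Close Scope ereal_scope.

Theorem theorem4p1 (R : realType) (d : nat) (X : set (d.-tuple R -> R))
  (nrm : (d.-tuple R -> R) -> R) :
  is_QBFS X nrm -> has_Fatou X nrm ->
  forall C : R, 0 <= C ->
  M_bounded X (fun f => (nrm f)%:E) C ->
  M_bounded (kothe (kothe X))
            (kothe_norm (kothe X) (kothe_norm X (fun f => (nrm f)%:E))) C.
Proof.
move=> QX _ C C0 MX f Xf; have [mf _] := Xf.
have [mu muE] := intRd_measure R d.
have Xm := QX.1.
have mQ := @measurable_rat_cube R d.
have mM : measurable_fun setT (HLmax f).
  by rewrite (HLmaxE muE mf); exact: measurable_sup_op.
have M0 x : (0 <= HLmax f x)%E by rewrite (HLmaxE muE mf) sup_op_ge0.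
have Mfin : aeRd (fun x => (HLmax f x < +oo)%E).
  apply/(aeRdP _ muE); apply: ae_lty_box => // N.
  have := integral_HLmax_bidual_lty muE QX MX Xf (box_in_kothe muE QX MX N).
  by under eq_integral do rewrite ger0_norm//.
have mMf : measurable_fun setT (fine \o HLmax f).
  by apply: measurableT_comp => //; exact: fine_measurable.
have pairE g : kothe X g ->
    intRd (fun x => (`|g x * (fine \o HLmax f) x|)%:E) =
    (\int[mu]_x ((`|g x|)%:E * HLmax f x))%E.
  move=> [mg _]; rewrite -(integral_HLmax_fine muE mf mg Mfin).
  by congr intRd; apply/funext => x; rewrite mulrC.
split => //.
  (* Membership concerns every [g] in X', whose norm may not be finite, so the estimate for norm 1
     below cannot be rescaled to it. *)
  split => // g Xg; rewrite pairE//.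
  exact: (integral_HLmax_bidual_lty muE QX MX).
apply: ge_ereal_sup => _ [->|[g [Xg g1] <-]].
  by rewrite mule_ge0// ?lee_fin//; apply: ereal_sup_ubound; left.
have [mg gX] := Xg.
rewrite pairE// (HLmaxE muE mf) integral_sup_op//; last exact: measurableT_comp.
apply: ge_ereal_sup => _ [k _ <-].
have [h [h0 mh -> hle]] := HLmax_dual k muE mf mg.
(* The norm of M on X enters here: [u] against [h] is at most M u against |g|, and [g] has norm 1,
   so [h] has Köthe norm at most [C]. *)
have pair_le u : X u ->
    (\int[mu]_x ((`|u x|)%:E * h x) <= C%:E * (nrm u)%:E)%E.
  move=> Xu; have mu_ := Xm _ Xu; have [ufin XMu nMu] := MX _ Xu.
  apply: le_trans (hle _ mu_) _; apply: le_trans nMu.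
  rewrite -(integral_HLmax_fine muE mu_ mg ufin).
  by apply: (kothe_pairing_le muE QX XMu Xg); rewrite g1.
have [|Xh hE] := kothe_fine muE QX MX h0 mh.
  by move=> u Xu; apply: le_lt_trans (pair_le _ Xu) _; rewrite -EFinM ltry.
rewrite -hE//; apply: (kothe_bidual_pairing_le muE QX MX) => //.
apply: ge_ereal_sup => _ [->|[u [Xu [u1]] <-]]; first by rewrite lee_fin.
by rewrite hE; [rewrite (le_trans (pair_le _ Xu))// u1 mule1|exact: Xm].
Qed.
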